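(* Let $n>2$ be even and $q\in\mathcal{B}_n$ with $$2^{n-1}-2^{n/2-1}\le wt(q)\le 2^{n-1}.$$ Then no non-linear (balanced) $q$-nearly bent function exists in $\mathcal{B}_n$.
   Context: $V_n=\{0,1\}^n$ (row vectors) and $\mathcal{B}_n$ is the set of Boolean functions $V_n\to\{0,1\}$. $wt(f)=|\{a: f(a)=1\}|$; $f$ is balanced if $wt(f)=2^{n-1}$. ''Non-linear'' means not affine (algebraic degree at least 2). $W(f,g)=\sum_{a\in V_n}(-1)^{f(a)+g(a)}$. $GL_n$ is the group of invertible $n\times n$ matrices over $\mathbb{F}_2$; $q_A(a)=q(aA)$; $W_q(f)(A)=W(f,q_A)$. $I_q=\sum_{a\in V_n}(-1)^{q(a)}$ and $\rho_q=\left\lceil\left(\frac{2^{2n}-I_q^2}{2^n-1}\right)^{1/2}\right\rceil$. A balanced $f\in\mathcal{B}_n$ is called $q$-nearly bent if $|W_q(f)(A)|\le\rho_q$ for all $A\in GL_n$. *)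

(* Defs.v *)
From mathcomp Require Import all_boot all_order all_algebra.
From mathcomp Require Import reals.

Set Implicit Arguments.
Unset Strict Implicit.
Unset Printing Implicit Defensive.

Import Order.TTheory GRing.Theory Num.Theory.
Local Open Scope ring_scope.

Definition bvec (n : nat) := 'rV['F_2]_n.

Definition boolfun (n : nat) := {ffun bvec n -> 'F_2}.

Section BooleanFunctions.
Variable n : nat.
Implicit Types f g q : boolfun n.

Definition wt f : nat := #|[set a | f a == 1]|.

(* The exponent n.-1 is the intended n - 1 only for n > 0. *)
Definition balanced f : Prop := wt f = (2 ^ n.-1)%N.

(* Algebraic degree at most 1: f(a) = a_1 c_1 + ... + a_n c_n + b. *)
Definition affine f : Prop :=
  exists (c : bvec n) (b : 'F_2),
    forall a : bvec n, f a = \sum_(i < n) a 0 i * c 0 i + b.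

Definition nonlinear f : Prop := ~ affine f.

(* The exponent is taken in 'F_2 and read as the natural number 0 or 1. *)
Definition W f g : int := \sum_(a : bvec n) (-1) ^+ (f a + g a).

Definition lin_act q (A : 'M['F_2]_n) : boolfun n := [ffun a => q (a *m A)].

Definition Wq q f (A : 'M['F_2]_n) : int := W f (lin_act q A).

Definition Iq q : int := \sum_(a : bvec n) (-1) ^+ (q a).

Definition rho (R : realType) q : int :=
  Num.ceil (Num.sqrt ((2 ^+ (2 * n) - (Iq q)%:~R ^+ 2) / (2 ^+ n - 1)) : R).

Definition nearly_bent (R : realType) q f : Prop :=
  balanced f /\
  forall A : 'M['F_2]_n, A \in unitmx -> `|Wq q f A| <= rho R q.

End BooleanFunctions.

(* Main.v *)
Require Import Defs.
From mathcomp Require Import all_boot all_order all_algebra.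
From mathcomp Require Import reals.
From mathcomp Require Import zify ring lra.

(** Write [N = 2^n = s^2], [F = (-1)^f], [Q = (-1)^q]. Since [W(f, q_A)] and [s]
    are even and [rho_q <= s + 1], nearly bentness gives [|W(f, q_A)| <= s] for all
    [A]. The mean of [W(f, q_A)^2] over [GL_n] is [(N^2 - I_q^2) / (N - 1) >= N], so
    [W(f, q_A)^2 = N] for every [A]. Summing [W(f, q_A)^2 Q(cA)] over [GL_n] for
    [c <> 0] and using that [GL_n] is transitive on linearly independent triples
    yields a relation [al C(c) + be F(c) = K] between [F] and its autocorrelation
    [C], with constants independent of [c]. If [al = 0] then [be <> 0], and [F] is
    constant away from [0], so not balanced. If [al <> 0], the Fourier transform
    of [F] takes two values [x], [y] on nonzero frequencies; its first two moments
    give [N^2 - (x + y) F(0) N + (N - 1) x y = 0], which forces [x] or [y] to be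
    [N] or [-N], that is, [f] affine. *)

(** * Transitivity of [GL_n] on independent tuples of vectors *)

Section GeneralLinearAverages.
Set Implicit Arguments.
Unset Strict Implicit.
Local Open Scope ring_scope.
Import Order.TTheory GRing.Theory Num.Theory.

Variable n : nat.
Local Notation V := 'rV['F_2]_n.
Implicit Types (a b c : V) (A : 'M['F_2]_n).

Lemma F2_cases (x : 'F_2) : x = 0 \/ x = 1.
Proof. by case: x => [[|[|m]] hm]; [left; exact/eqP | right; exact/eqP | ]. Qed.

Lemma sq_eq1 (x : int) : x * x = 1 -> x = 1 \/ x = -1.
Proof. nia. Qed.

Lemma addrr_F2 a : a + a = 0.
Proof.
by apply/matrixP=> i j; rewrite !mxE; case: (F2_cases (a i j)) => ->; apply/eqP.
Qed.

Lemma oppr_F2 a : - a = a.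
Proof. by apply/eqP; rewrite eq_sym -subr_eq0 opprK addrr_F2. Qed.

(** Matrices of full row rank satisfy [Y = X *m B] for some invertible [B], and sending [A] to
    [B *m A] permutes [GL_n]. *)
Lemma GL_sum_row_free k (X Y : 'M['F_2]_(k, n)) (phi : 'M['F_2]_(k, n) -> int) :
  row_free X -> row_free Y ->
  \sum_(A in unitmx) phi (X *m A) = \sum_(A in unitmx) phi (Y *m A).
Proof.
move=> fX fY; have XY : X *m (pinvmx X *m Y) = Y by rewrite mulmxA mulmxVp ?mul1mx.
have [|B uB] := @complete_unitmx _ _ _ X (pinvmx X *m Y).
  by rewrite XY (eqP fX) (eqP fY).
rewrite XY => {XY} ->; rewrite (reindex_inj (can_inj (mulKmx uB))) /=.
by apply: eq_big => [A|A _]; rewrite ?unitmx_mul ?uB ?mulmxA.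
Qed.

Lemma row_free1 a : a != 0 -> row_free a.
Proof.
move=> a0; apply: inj_row_free => v; rewrite (mx11_scalar v) mul_scalar_mx.
by case: (F2_cases (v 0 0)) => ->; rewrite ?scale1r ?raddf0 // => /eqP; rewrite (negPf a0).
Qed.

Lemma row_free2 a b : a != 0 -> b != 0 -> a != b -> row_free (col_mx a b).
Proof.
move=> a0 b0 ab; apply: inj_row_free => v.
rewrite -(hsubmxK v) mul_row_col (mx11_scalar (lsubmx v)) (mx11_scalar (rsubmx v)).
rewrite !mul_scalar_mx.
case: (F2_cases (lsubmx v 0 0)) => ->; case: (F2_cases (rsubmx v 0 0)) => ->;
  rewrite ?scale1r ?scale0r ?add0r ?addr0 => /eqP.
- by rewrite raddf0 row_mx0.
- by rewrite (negPf b0).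
- by rewrite (negPf a0).
- by rewrite addr_eq0 oppr_F2 (negPf ab).
Qed.

(** Linear independence over [F_2]: each condition says that one of the seven nontrivial
    combinations is nonzero. *)
Definition independent3 a b c :=
  [&& a != 0, b != 0, a != b, c != 0, c != a, c != b & c != a + b].

Lemma row_free3 a b c : independent3 a b c -> row_free (col_mx a (col_mx b c)).
Proof.
case/and5P=> a0 b0 ab c0 /and3P[ca cb cab]; apply: inj_row_free => v.
rewrite -(hsubmxK v) mul_row_col; set u := rsubmx v.
rewrite -(hsubmxK u) mul_row_col (mx11_scalar (lsubmx v)) (mx11_scalar (lsubmx u)).
rewrite (mx11_scalar (rsubmx u)) !mul_scalar_mx.
case: (F2_cases (lsubmx v 0 0)) => ->; case: (F2_cases (lsubmx u 0 0)) => ->;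
  case: (F2_cases (rsubmx u 0 0)) => ->;
  rewrite ?scale1r ?scale0r ?add0r ?addr0 => /eqP.
- by rewrite raddf0 !row_mx0.
- by rewrite (negPf c0).
- by rewrite (negPf b0).
- by rewrite addr_eq0 oppr_F2 eq_sym (negPf cb).
- by rewrite (negPf a0).
- by rewrite addr_eq0 oppr_F2 eq_sym (negPf ca).
- by rewrite addr_eq0 oppr_F2 (negPf ab).
- by rewrite addrA addr_eq0 oppr_F2 eq_sym (negPf cab).
Qed.

Variable Q : V -> int.

Lemma GL_sum1 a a' : a != 0 -> a' != 0 ->
  \sum_(A in unitmx) Q (a *m A) = \sum_(A in unitmx) Q (a' *m A).
Proof. by move=> a0 a'0; apply: GL_sum_row_free; apply: row_free1. Qed.

Lemma GL_sum2 (phi : V -> V -> int) a b a' b' :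
  a != 0 -> b != 0 -> a != b -> a' != 0 -> b' != 0 -> a' != b' ->
  \sum_(A in unitmx) phi (a *m A) (b *m A) =
  \sum_(A in unitmx) phi (a' *m A) (b' *m A).
Proof.
move=> a0 b0 ab a'0 b'0 ab'.
have := @GL_sum_row_free _ (col_mx a b) (col_mx a' b')
  (fun X => phi (usubmx X) (dsubmx X)) (row_free2 a0 b0 ab) (row_free2 a'0 b'0 ab').
by under eq_bigr do rewrite mul_col_mx col_mxKu col_mxKd;
  under [X in _ = X]eq_bigr do rewrite mul_col_mx col_mxKu col_mxKd.
Qed.

Lemma GL_sum3 (phi : V -> V -> V -> int) a b c a' b' c' :
  independent3 a b c -> independent3 a' b' c' ->
  \sum_(A in unitmx) phi (a *m A) (b *m A) (c *m A) =
  \sum_(A in unitmx) phi (a' *m A) (b' *m A) (c' *m A).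
Proof.
move=> i i'.
have := @GL_sum_row_free _ (col_mx a (col_mx b c)) (col_mx a' (col_mx b' c'))
  (fun X => phi (usubmx X) (usubmx (dsubmx X)) (dsubmx (dsubmx X)))
  (row_free3 i) (row_free3 i').
by under eq_bigr do rewrite !mul_col_mx !(col_mxKu, col_mxKd);
  under [X in _ = X]eq_bigr do rewrite !mul_col_mx !(col_mxKu, col_mxKd).
Qed.

End GeneralLinearAverages.

(** * Second and third moments of the correlations over [GL_n] *)

Section Moments.
Set Implicit Arguments.
Unset Strict Implicit.
Local Open Scope ring_scope.
Import Order.TTheory GRing.Theory Num.Theory.

Variable n : nat.
Local Notation V := 'rV['F_2]_n.
Implicit Types (a b c : V) (A : 'M['F_2]_n).
Variables (F Q : V -> int).
Hypothesis F_sq : forall a, F a * F a = 1.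
Hypothesis Q_sq : forall a, Q a * Q a = 1.
Hypothesis F_sum : \sum_a F a = 0.

Local Notation N := (#|{: V}|%:Z).
Local Notation G := (\sum_(A : 'M['F_2]_n | A \in unitmx) (1 : int)).
Local Notation I := (\sum_a Q a).

Definition autocorr c := \sum_a F a * F (c + a).
(** For [F = (-1)^f] and [Q = (-1)^q] this is [W(f, q_A)]. *)
Definition correlation A := \sum_a F a * Q (a *m A).

Lemma sum_delta (g : V -> int) x : \sum_b g b * (b == x)%:R = g x.
Proof.
rewrite (bigD1 x) //= eqxx mulr1 big1 ?addr0 // => b /negPf ->.
by rewrite mulr0.
Qed.

Lemma sum_const (x : int) : \sum_(a : V) x = N * x.
Proof. by rewrite sumr_const -mulr_natl natz. Qed.

(** The contributions of [u] and [v] vanish because [F] sums to zero; what remains is the diagonal,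
    the line [b = c + a], and the four corners with [a], [b] in [{0, c}]. *)
Lemma quadratic_sum (K : V -> V -> int) (u v : V -> int) (d t p0 pc l : int) c :
  (forall a b, K a b = u a + v b + d * (b == a)%:R + t * (b == c + a)%:R
     + p0 * (a == 0)%:R * (b == 0)%:R + pc * (a == c)%:R * (b == c)%:R
     + l * (a == 0)%:R * (b == c)%:R + l * (a == c)%:R * (b == 0)%:R) ->
  \sum_a \sum_b F a * F b * K a b =
  d * N + t * autocorr c + p0 + pc + l * 2 * F 0 * F c.
Proof.
move=> hK; pose U := \sum_b F b * v b.
transitivity (\sum_a (F a * U + d * 1 + t * (F a * F (c + a))
   + p0 * F 0 * (F a * (a == 0)%:R) + pc * F c * (F a * (a == c)%:R)
   + l * F c * (F a * (a == 0)%:R) + l * F 0 * (F a * (a == c)%:R))).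
  apply: eq_bigr => a _.
  transitivity (\sum_b (F a * u a * F b + F a * (F b * v b)
     + d * F a * (F b * (b == a)%:R) + t * F a * (F b * (b == c + a)%:R)
     + p0 * F a * (a == 0)%:R * (F b * (b == 0)%:R)
     + pc * F a * (a == c)%:R * (F b * (b == c)%:R)
     + l * F a * (a == 0)%:R * (F b * (b == c)%:R)
     + l * F a * (a == c)%:R * (F b * (b == 0)%:R))).
    by apply: eq_bigr => b _; rewrite hK; ring.
  rewrite !big_split /= -!mulr_sumr F_sum !sum_delta -/U -[1](F_sq a); ring.
rewrite !big_split /= -!mulr_sumr -mulr_suml F_sum !sum_delta sum_const.
have := F_sq 0; have := F_sq c; rewrite /autocorr => e1 e2.
rewrite -!mulrA e1 e2; ring.
Qed.

Lemma sum_correlation_sq (h : 'M['F_2]_n -> int) :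
  \sum_(A in unitmx) correlation A ^+ 2 * h A =
  \sum_a \sum_b F a * F b * (\sum_(A in unitmx) Q (a *m A) * Q (b *m A) * h A).
Proof.
under [RHS]eq_bigr do under eq_bigr do rewrite mulr_sumr.
under [RHS]eq_bigr do rewrite exchange_big /=.
rewrite exchange_big /=; apply: eq_bigr => A _.
rewrite expr2 {1}/correlation mulr_suml mulr_suml; apply: eq_bigr => a _.
rewrite /correlation mulr_sumr mulr_suml; apply: eq_bigr => b _; ring.
Qed.

Lemma sum_mulmx A : A \in unitmx -> \sum_a Q (a *m A) = I.
Proof.
by move=> uA; rewrite [RHS](reindex_inj (can_inj (mulmxK uA))).
Qed.

(* A base point of each of the GL-orbits occurring below. *)
Variables (a0 b0 c0 : V).
Hypothesis ind0 : independent3 a0 b0 c0.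

(** Three distinct nonzero vectors are of two types: independent triples ([T3]) and triples with sum
    zero ([Tl]). *)
Local Notation E1 := (\sum_(A in unitmx) Q (a0 *m A)).
Local Notation E2 := (\sum_(A in unitmx) Q (a0 *m A) * Q (b0 *m A)).
Local Notation T3 :=
  (\sum_(A in unitmx) Q (a0 *m A) * Q (b0 *m A) * Q (c0 *m A)).
Local Notation Tl :=
  (\sum_(A in unitmx) Q (a0 *m A) * Q (b0 *m A) * Q ((a0 + b0) *m A)).

Let a0N : a0 != 0. Proof. by case/andP: ind0. Qed.
Let b0N : b0 != 0. Proof. by case/and3P: ind0. Qed.
Let ab0 : a0 != b0. Proof. by case/and4P: ind0. Qed.

Let E1E a : a != 0 -> \sum_(A in unitmx) Q (a *m A) = E1.
Proof. by move=> h; apply: GL_sum1. Qed.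

Let E2E a b : a != 0 -> b != 0 -> a != b ->
  \sum_(A in unitmx) Q (a *m A) * Q (b *m A) = E2.
Proof. by move=> *; apply: (GL_sum2 (fun a b => Q a * Q b)). Qed.

Let QQ A a : Q (a *m A) * Q (a *m A) = 1. Proof. exact: Q_sq. Qed.

(** Double counting over nonzero [a] and invertible [A]: each [A] permutes the nonzero vectors. *)
Lemma E1_value : (N - 1) * E1 = G * (I - Q 0).
Proof.
transitivity (\sum_(a : V | a != 0) \sum_(A in unitmx) Q (a *m A)).
  under [RHS]eq_bigr => a h do rewrite (E1E h).
  by rewrite mulrBl mul1r -sum_const (bigD1 (0 : V)) //= addrAC subrr add0r.
rewrite exchange_big mulr_suml; apply: eq_bigr => A uA /=.
by rewrite mul1r -(sum_mulmx uA) [X in _ = X - _](bigD1 (0 : V)) //= mul0mx addrC addrK.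
Qed.

(** Double counting with one vector fixed at [a0]; the term [a = a0] contributes [G] because [Q]
    squares to 1. *)
Lemma E2_value : G + (N - 2) * E2 = E1 * (I - Q 0).
Proof.
transitivity (\sum_(a : V | a != 0) \sum_(A in unitmx) Q (a0 *m A) * Q (a *m A)).
  rewrite (bigD1 a0) //=; congr (_ + _).
    by apply: eq_bigr => A _; rewrite QQ.
  under [RHS]eq_bigr => a /andP[h h'] do rewrite (E2E a0N h) 1?eq_sym //.
  have -> : (N - 2) * E2 = N * E2 - E2 - E2 by ring.
  rewrite -sum_const (bigD1 (0 : V)) //= (bigD1 a0) //=; ring.
rewrite exchange_big mulr_suml; apply: eq_bigr => A uA /=.
rewrite -(sum_mulmx uA) [X in _ = _ * (X - _)](bigD1 (0 : V)) //= mul0mx addrAC subrr add0r.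
by rewrite mulr_sumr.
Qed.

Lemma second_moment :
  (N - 1) * (\sum_(A in unitmx) correlation A ^+ 2) = G * (N ^+ 2 - I ^+ 2).
Proof.
under eq_bigr do rewrite -[_ ^+ 2]mulr1.
rewrite sum_correlation_sq.
(* The kernel is [G] on the diagonal, [Q 0 * E1] when exactly one argument is 0, and [E2] elsewhere;
   the coefficient with [- 2] cancels the row and column corrections, which both act at [(0, 0)]. *)
rewrite (@quadratic_sum _ (fun a => E2 + (Q 0 * E1 - E2) * (a == 0)%:R)
  (fun b => (Q 0 * E1 - E2) * (b == 0)%:R) (G - E2) 0
  (- 2 * (Q 0 * E1 - E2)) 0 0 0).
  have h1 := E1_value; have h2 := E2_value; have h3 := Q_sq 0.
  (* Regrouped so that [E1] and [E2] occur only through the left sides of [E1_value] and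
     [E2_value]. *)
  have -> : (N - 1) * ((G - E2) * N + 0 * autocorr 0 + -2 * (Q 0 * E1 - E2) + 0 +
      0 * 2 * F 0 * F 0) = (N - 1) * (N * G + G)
       - (N - 1) * (G + (N - 2) * E2) - 2 * Q 0 * ((N - 1) * E1) by ring.
  rewrite h2 mulrA h1.
  have -> : G * (N ^+ 2 - I ^+ 2) = G * (N ^+ 2 - 1 - I ^+ 2 + Q 0 * Q 0) by rewrite h3; ring.
  ring.
move=> a b; under eq_bigr do rewrite mulr1.
rewrite !mul0r !addr0.
have [-> | ba] := eqVneq b a.
  under eq_bigr do rewrite QQ.
  by case: (a == 0); rewrite /=; ring.
have [a_0 | aN] := eqVneq a 0.
  have bN : b != 0 by rewrite -a_0.
  rewrite a_0; under eq_bigr do rewrite mul0mx.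
  rewrite -mulr_sumr E1E // (negPf bN) /=; ring.
have [b_0 | bN] := eqVneq b 0.
  rewrite b_0; under eq_bigr do rewrite mul0mx.
  rewrite -mulr_suml E1E //=; ring.
rewrite E2E //= 1?[a == b]eq_sym //; ring.
Qed.

(* Each entry of the kernel depends only on the GL-type of [(a, b, c)]. *)
Lemma third_moment c : c != 0 ->
  \sum_(A in unitmx) correlation A ^+ 2 * Q (c *m A) =
  (Tl - T3) * autocorr c
  + 2 * (Q 0 * G - E1 - Q 0 * E2 + 2 * T3 - Tl) * F 0 * F c
  + ((E1 - T3) * N - 2 * (Q 0 * E2 - T3) - 2 * (E1 - T3)).
Proof.
move=> cN; rewrite sum_correlation_sq.
(* The generic entry is [T3]. It becomes [E1] on the diagonal, [Tl] on [a + b = c], [Q 0 * E2] in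
   row and column 0, and [E1] in row and column [c]. The last three coefficients restore the
   corners: [E1] at [(0, 0)] and [(c, c)], [Q 0 * G] at the mixed ones. *)
rewrite (@quadratic_sum _
  (fun a => T3 + (Q 0 * E2 - T3) * (a == 0)%:R + (E1 - T3) * (a == c)%:R)
  (fun b => (Q 0 * E2 - T3) * (b == 0)%:R + (E1 - T3) * (b == c)%:R)
  (E1 - T3) (Tl - T3) (- 2 * (Q 0 * E2 - T3)) (- 2 * (E1 - T3))
  (Q 0 * G - E1 - Q 0 * E2 + 2 * T3 - Tl) c); first by ring.
move=> a b; have Nc : (0 == c) = false by rewrite eq_sym (negPf cN).
have [-> | ba] := eqVneq b a.
  under eq_bigr do rewrite QQ mul1r.
  have -> : (a == c + a) = false by rewrite -[X in X == _]add0r (inj_eq (addIr a)).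
  rewrite E1E //.
  have [-> | aN] := eqVneq a 0; first by rewrite Nc /=; ring.
  by case: (a == c); rewrite /=; ring.
have [a_0 | aN] := eqVneq a 0.
  have bN : b != 0 by rewrite -a_0.
  rewrite a_0 addr0 Nc (negPf bN).
  under eq_bigr do rewrite mul0mx -mulrA.
  rewrite -mulr_sumr.
  have [-> | bc] := eqVneq b c.
    by under eq_bigr do rewrite QQ; rewrite /=; ring.
  by rewrite E2E //=; ring.
have [a_c | ac] := eqVneq a c.
  have bc : b != c by rewrite -a_c.
  rewrite a_c addrr_F2 (negPf bc).
  under eq_bigr do rewrite mulrAC QQ mul1r.
  have [-> | bN] := eqVneq b 0.
    under eq_bigr do rewrite mul0mx -[Q 0]mulr1.
    rewrite -mulr_sumr /=; ring.
  by rewrite E1E //=; ring.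
have [b_0 | bN] := eqVneq b 0.
  rewrite b_0; under eq_bigr do rewrite mul0mx mulrAC mulrC.
  rewrite -mulr_sumr E2E //.
  have -> : (0 == c + a) = false.
    by apply/negbTE; apply: contra ac; rewrite eq_sym addr_eq0 oppr_F2 eq_sym.
  by rewrite Nc /=; ring.
have [b_c | bc] := eqVneq b c.
  have -> : (b == c + a) = false.
    by rewrite b_c -[X in X == _]addr0 (inj_eq (addrI c)) eq_sym (negPf aN).
  rewrite b_c; under eq_bigr do rewrite -mulrA QQ mulr1.
  rewrite E1E //=; ring.
have [bca | bca] := eqVneq b (c + a).
  (* With [c = a + b] the summand depends on the pair [(a, b)] alone, so transitivity on pairs
     suffices. *)
  have -> : \sum_(A in unitmx) Q (a *m A) * Q (b *m A) * Q (c *m A) = Tl.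
    have -> : c = a + b by rewrite bca addrCA addrr_F2 addr0.
    under eq_bigr do rewrite mulmxDl.
    under [RHS]eq_bigr do rewrite mulmxDl.
    by apply: (GL_sum2 (fun a b => Q a * Q b * Q (a + b))); rewrite // eq_sym.
  rewrite /=; ring.
have -> : \sum_(A in unitmx) Q (a *m A) * Q (b *m A) * Q (c *m A) = T3.
  apply: (GL_sum3 (fun a b c => Q a * Q b * Q c)) => //.
  rewrite /independent3 aN bN eq_sym ba cN eq_sym ac eq_sym bc /=.
  apply: contra bca => /eqP ->; by rewrite addrAC addrr_F2 add0r.
rewrite /=; ring.
Qed.

Hypothesis Qa0 : Q a0 = - Q 0.
Hypothesis Qb0 : Q b0 = - Q 0.
Hypothesis Qc0 : Q c0 = Q 0.

(** Up to a nonzero factor this is the coefficient of [F c] in [third_moment] when [Tl = T3]. It is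
    a sum over [GL_n] of products of two nonnegative factors, and the prescribed signs at the base
    points make the identity matrix contribute 4. *)
Lemma degenerate_coefficient : 0 < Q 0 * (Q 0 * G - E1 - Q 0 * E2 + T3).
Proof.
have -> : Q 0 * (Q 0 * G - E1 - Q 0 * E2 + T3) =
   \sum_(A in unitmx) (1 - Q 0 * Q (a0 *m A)) * (1 - Q (b0 *m A) * Q (c0 *m A)).
  have e : E2 = \sum_(A in unitmx) Q (b0 *m A) * Q (c0 *m A).
    by case/and5P: ind0 => _ _ _ c0N /and3P[_ cb0 _]; rewrite (E2E b0N c0N) 1?eq_sym.
  rewrite e; transitivity (Q 0 * Q 0 * G - Q 0 * E1 - Q 0 * Q 0 * E2 + Q 0 * T3).
    rewrite e; ring.
  rewrite Q_sq e !mul1r !mulr_sumr -!sumrB -big_split /=; apply: eq_bigr => A _; ring.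
rewrite (bigD1 1%:M) ?unitmx1 //= !mulmx1 Qa0 Qb0 Qc0.
have h := Q_sq 0.
apply: ltr_wpDr; last by rewrite mulrN mulNr h.
apply: sumr_ge0 => A _.
by case: (sq_eq1 (Q_sq 0)) => ->; case: (sq_eq1 (Q_sq (a0 *m A))) => ->;
  case: (sq_eq1 (Q_sq (b0 *m A))) => ->; case: (sq_eq1 (Q_sq (c0 *m A))) => ->.
Qed.

End Moments.

(** * Fourier analysis on [V_n] and the two-valued spectrum *)

Section Fourier.
Set Implicit Arguments.
Unset Strict Implicit.
Local Open Scope ring_scope.
Import Order.TTheory GRing.Theory Num.Theory.

Definition sgn2 (x : 'F_2) : int := (-1) ^+ x.

Lemma sgn2D x y : sgn2 (x + y) = sgn2 x * sgn2 y.
Proof. by case: (F2_cases x) => ->; case: (F2_cases y) => ->. Qed.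

Lemma sgn2_sq x : sgn2 x * sgn2 x = 1.
Proof. by case: (F2_cases x) => ->. Qed.

Lemma sgn2_inj : injective sgn2.
Proof. by move=> x y; case: (F2_cases x) => ->; case: (F2_cases y) => ->. Qed.

Variable n : nat.
Local Notation V := 'rV['F_2]_n.
Implicit Types (a b c w : V).
Local Notation N := (#|{: V}|%:Z).

(** The exponent has the shape of the linear part in [affine]. *)
Definition character w a : int := sgn2 (\sum_(i < n) a 0 i * w 0 i).

Lemma characterC w a : character w a = character a w.
Proof. by congr sgn2; apply: eq_bigr => i _; rewrite mulrC. Qed.

Lemma characterD w a b : character w (a + b) = character w a * character w b.
Proof.
rewrite -sgn2D -big_split; congr sgn2; apply: eq_bigr => i _.
by rewrite !mxE mulrDl.
Qed.

Lemma character0 w : character w 0 = 1.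
Proof. by rewrite /character big1 // => i _; rewrite mxE mul0r. Qed.

(** Translation by a unit vector [e_i] with [w_i = 1] reverses the sign of the sum. *)
Lemma character_sum w : w != 0 -> \sum_a character w a = 0.
Proof.
move=> w0; have [i wi] : exists i, w 0 i = 1.
  have [i wi] := rV0Pn _ w0; exists i.
  by case: (F2_cases (w 0 i)) wi => ->; rewrite ?eqxx.
have e : character w (delta_mx 0 i) = -1.
  rewrite /character (bigD1 i) //= mxE !eqxx mul1r wi big1 ?addr0 // => j ji.
  by rewrite mxE (negPf ji) mul0r.
have : \sum_a character w a = - \sum_a character w a.
  rewrite {1}(reindex_inj (addrI (delta_mx 0 i))) -sumrN; apply: eq_bigr => a _.
  by rewrite characterD e mulN1r.
lia.
Qed.

Lemma character_sum_dual a : \sum_w character w a = N * (a == 0)%:R.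
Proof.
under eq_bigr do rewrite characterC.
have [-> | a0] := eqVneq a 0; last by rewrite character_sum // mulr0.
by under eq_bigr do rewrite characterC character0; rewrite sum_const.
Qed.

Variable F : V -> int.
Hypothesis F_sq : forall a, F a * F a = 1.
Hypothesis F_sum : \sum_a F a = 0.

Definition fourier w : int := \sum_a F a * character w a.

Lemma fourier0 : fourier 0 = 0.
Proof.
by rewrite -[RHS]F_sum; apply: eq_bigr => a _; rewrite characterC character0 mulr1.
Qed.

Lemma sum_fourier : \sum_w fourier w = N * F 0.
Proof.
rewrite exchange_big /=.
under eq_bigr do rewrite -mulr_sumr character_sum_dual mulrCA.
by rewrite -mulr_sumr sum_delta.
Qed.

(** The Wiener-Khinchin identity, by the substitution [c = a + b] in the double sum. *)
Lemma fourier_autocorr w : fourier w ^+ 2 = \sum_c autocorr F c * character w c.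
Proof.
under eq_bigr do rewrite /autocorr mulr_suml.
rewrite exchange_big expr2 {1}/fourier mulr_suml; apply: eq_bigr => a _ /=.
rewrite [RHS](reindex_inj (addIr a)) /fourier mulr_sumr; apply: eq_bigr => b _.
by rewrite -addrA addrr_F2 addr0 characterD; ring.
Qed.

Lemma autocorr0 : autocorr F 0 = N.
Proof.
rewrite -[RHS]mulr1 -sum_const; apply: eq_bigr => a _.
by rewrite add0r F_sq.
Qed.

Lemma parseval : \sum_w fourier w ^+ 2 = N ^+ 2.
Proof.
under eq_bigr do rewrite fourier_autocorr.
rewrite exchange_big /=.
under eq_bigr do rewrite -mulr_sumr character_sum_dual mulrCA.
by rewrite -mulr_sumr sum_delta autocorr0.
Qed.

Lemma fourier_le w : - N <= fourier w <= N.
Proof.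
have -> : N = \sum_(a : V) 1 by rewrite sum_const mulr1.
rewrite -sumrN; apply/andP; split; apply: ler_sum => a _;
  have := F_sq a; have := sgn2_sq (\sum_(i < n) a 0 i * w 0 i);
  rewrite -/(character w a); nia.
Qed.

(** Transform the relation at [w]: the term [c = 0] gives [al * N + be * F 0], and the characters
    over [c != 0] sum to -1, whence [- K]. *)
Lemma fourier_relation al be K : (forall c, c != 0 -> al * autocorr F c + be * F c = K) ->
  forall w, w != 0 -> al * fourier w ^+ 2 + be * fourier w = al * N + be * F 0 - K.
Proof.
move=> h w w0; rewrite fourier_autocorr /fourier !mulr_sumr -big_split /=.
rewrite (bigD1 0) //= character0 !mulr1 autocorr0; congr (_ + _).
have : K * \sum_c character w c = 0 by rewrite character_sum // mulr0.
rewrite (bigD1 0) //= character0 mulrDr mulr1 mulr_sumr => /eqP.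
rewrite addrC addr_eq0 => /eqP <-; apply: eq_bigr => c c0; rewrite -(h _ c0); ring.
Qed.

(** The equation becomes [x * y = M * z] and [x + y = M + (M - 1) * z] with an integer [z]; the
    bounds on [x] and [y] leave only the values of [z] from -3 to 1. *)
Lemma two_values_extremal (M s x y : int) :
  M = s * s -> 4 <= s -> - M <= x <= M -> - M <= y <= M ->
  M * M - (x + y) * M + (M - 1) * (x * y) = 0 ->
  [\/ x = M, x = - M, y = M | y = - M].
Proof.
move=> hM hs hx hy h; pose z := x * y + M - (x + y).
have xy : x * y = M * z by rewrite /z; lia.
have xpy : x + y = M + (M - 1) * z by rewrite mulrBl -xy /z; lia.
clearbody z.
have M16 : 16 <= M.
  have : 0 <= (s - 4) * (s + 4) by apply: mulr_ge0; lia.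
  by lia.
have z_le1 : z <= 1.
  rewrite leNgt; apply/negP => z2.
  have : 0 <= (M - 1) * (z - 2) by apply: mulr_ge0; lia.
  by lia.
have z_ge3 : -3 <= z.
  rewrite leNgt; apply/negP => z2.
  have : 0 <= (M - 1) * (-4 - z) by apply: mulr_ge0; lia.
  by lia.
have [z1|[z1|[z1|[z1|z1]]]] : z = 1 \/ z = 0 \/ z = -1 \/ z = -2 \/ z = -3 by lia.
- have [] : x = M \/ y = M by lia.
    by constructor 1.
  by constructor 3.
- have /eqP : x * y = 0 by rewrite xy z1 mulr0.
  by rewrite mulf_eq0 => /orP[] /eqP h0; [constructor 3|constructor 1]; lia.
(* Here M = x (x - 1) is not a square. *)
- exfalso; have ex : s * s = x * x - x.
    have yE : y = 1 - x by lia.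
    by move: xy; rewrite yE z1; lia.
  have [x1|x0] : 1 <= x \/ x <= 0 by lia.
    have [sx|sx] : x <= s \/ s <= x - 1 by lia.
      have : 0 <= (s - x) * (s + x) by apply: mulr_ge0; lia.
      by lia.
    have : 0 <= (x - 1 - s) * (x - 1 + s) by apply: mulr_ge0; lia.
    by lia.
  have [sx|sx] : s <= - x \/ 1 - x <= s by lia.
    have : 0 <= (- x - s) * (- x + s) by apply: mulr_ge0; lia.
    by lia.
  have : 0 <= (s - (1 - x)) * (s + (1 - x)) by apply: mulr_ge0; lia.
  by lia.
(* Sum [2 - M] and product [- 2 * M]: the roots are 2 and [- M]. *)
- have /eqP : (x - 2) * (x + M) = 0.
    have yE : y = 2 - M - x by lia.
    by move: xy; rewrite yE z1; lia.
  by rewrite mulf_eq0 => /orP[] /eqP h0; [constructor 4|constructor 2]; lia.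
(* The sum [3 - 2 * M] makes both numbers negative, but the product is [- 3 * M]. *)
- exfalso.
  have : 0 <= (- x) * (- y) by apply: mulr_ge0; lia.
  by lia.
Qed.

(** Nonzero frequencies give roots of one quadratic, as [al != 0]. If both roots occur, the first
    two moments lead to [two_values_extremal]; a single value would make [N - 1] divide [N]. *)
Lemma fourier_extremal (s al be K : int) : N = s * s -> 4 <= s -> al != 0 ->
  (forall c, c != 0 -> al * autocorr F c + be * F c = K) ->
  exists w, fourier w = N \/ fourier w = - N.
Proof.
move=> Ns s4 al0 /fourier_relation rel.
have [w1 w1N] : exists w : V, w != 0.
  have [w wN|h] := pickP (fun w : V => w != 0); first by exists w.
  exfalso; have := F_sq 0; have := F_sum.
  by rewrite (bigD1 0) //= big_pred0 // addr0 => ->.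
have sum1 : \sum_(w | w != 0) fourier w = N * F 0.
  by rewrite -sum_fourier [RHS](bigD1 0) //= fourier0 add0r.
have sum2 : \sum_(w | w != 0) fourier w ^+ 2 = N ^+ 2.
  by rewrite -parseval [RHS](bigD1 0) //= fourier0 expr0n add0r.
have sum0 (x : int) : \sum_(w : V | w != 0) x = (N - 1) * x.
  by rewrite mulrBl mul1r -sum_const [X in _ = X - _](bigD1 0) //= addrAC subrr add0r.
have [w2 /andP[w2N w12]|] := pickP [pred w | (w != 0) && (fourier w != fourier w1)].
  have xy : al * (fourier w1 + fourier w2) + be = 0.
    have : (fourier w2 - fourier w1) * (al * (fourier w1 + fourier w2) + be) = 0.
      by have := rel _ w1N; have := rel _ w2N; lia.
    by move/eqP; rewrite mulf_eq0 subr_eq0 (negPf w12) => /eqP.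
  have two w : w != 0 -> (fourier w - fourier w1) * (fourier w - fourier w2) = 0.
    move=> wN; have /eqP : al * ((fourier w - fourier w1) * (fourier w - fourier w2)) = 0.
      transitivity (al * fourier w ^+ 2 + be * fourier w
        - (al * fourier w1 ^+ 2 + be * fourier w1)
        - (fourier w - fourier w1) * (al * (fourier w1 + fourier w2) + be)); first by ring.
      by rewrite xy rel // rel // subrr mulr0 subr0.
    by rewrite mulf_eq0 (negPf al0) => /eqP.
  have : \sum_(w | w != 0) (fourier w - fourier w1) * (fourier w - fourier w2) = 0.
    by rewrite big1.
  have -> : \sum_(w | w != 0) (fourier w - fourier w1) * (fourier w - fourier w2) =
     \sum_(w | w != 0) (fourier w ^+ 2 - (fourier w1 + fourier w2) * fourier w
        + fourier w1 * fourier w2) by apply: eq_bigr => w _; ring.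
  rewrite big_split sumrB /= -mulr_sumr sum0 sum1 sum2 => h.
  (* Multiplying both values by the sign [F 0] reduces to the case [F 0 = 1]. *)
  have norm_F0 x : - N <= x <= N -> - N <= F 0 * x <= N.
    by case: (sq_eq1 (F_sq 0)) => ->; lia.
  have [] := two_values_extremal Ns s4 (norm_F0 _ (fourier_le w1)) (norm_F0 _ (fourier_le w2)).
  - rewrite mulrACA F_sq mul1r -[RHS]h; ring.
  - by move=> h0; exists w1; case: (sq_eq1 (F_sq 0)) h0 => ->; lia.
  - by move=> h0; exists w1; case: (sq_eq1 (F_sq 0)) h0 => ->; lia.
  - by move=> h0; exists w2; case: (sq_eq1 (F_sq 0)) h0 => ->; lia.
  - by move=> h0; exists w2; case: (sq_eq1 (F_sq 0)) h0 => ->; lia.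
move=> eqw; exfalso.
have : \sum_(w | w != 0) fourier w = (N - 1) * fourier w1.
  rewrite -sum0; apply: eq_bigr => w wN; apply/eqP.
  by have := eqw w; rewrite /= wN /= => /negbFE.
rewrite sum1 => h.
have N16 : 16 <= N.
  have : 0 <= (s - 4) * (s + 4) by apply: mulr_ge0; lia.
  by lia.
have [y hy] : exists y, N = (N - 1) * y.
  case: (sq_eq1 (F_sq 0)) => F0; [exists (fourier w1)|exists (- fourier w1)];
    move: h; rewrite F0; lia.
have [y2|[y0|y1]] : 2 <= y \/ y <= 0 \/ y = 1 by lia.
- have : 0 <= (N - 1) * (y - 2) by apply: mulr_ge0; lia.
  by lia.
- have : 0 <= (N - 1) * (- y) by apply: mulr_ge0; lia.
  by lia.
- by move: hy; rewrite y1; lia.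
Qed.

End Fourier.

(** * Rigidity of small correlations, and its application to [f] and [q] *)

Section NearlyBent.
Set Implicit Arguments.
Unset Strict Implicit.
Local Open Scope ring_scope.
Import Order.TTheory GRing.Theory Num.Theory.

Variable n : nat.
Local Notation V := 'rV['F_2]_n.
Implicit Types (a b c w : V) (A : 'M['F_2]_n).
Local Notation N := (#|{: V}|%:Z).

Lemma small_correlation_extremal (F Q : V -> int) (s : int) (a0 b0 c0 : V) :
  (forall a, F a * F a = 1) -> (forall a, Q a * Q a = 1) -> \sum_a F a = 0 ->
  N = s * s -> 4 <= s -> (\sum_a Q a) ^+ 2 <= N ->
  independent3 a0 b0 c0 -> Q a0 = - Q 0 -> Q b0 = - Q 0 -> Q c0 = Q 0 ->
  (forall A, A \in unitmx -> correlation F Q A ^+ 2 <= N) ->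
  exists w, fourier F w = N \/ fourier F w = - N.
Proof.
move=> F_sq Q_sq F_sum Ns s4 I_le ind0 Qa0 Qb0 Qc0 W_le.
have N16 : 16 <= N.
  have : 0 <= (s - 4) * (s + 4) by apply: mulr_ge0; lia.
  by lia.
have moment2 := second_moment F_sq Q_sq F_sum ind0.
pose G : int := \sum_(A : 'M['F_2]_n | A \in unitmx) 1.
have G0 : 0 <= G by apply: sumr_ge0.
(* The deficits [N - correlation F Q A ^+ 2] are nonnegative, and by [second_moment] with
   [I_q^2 <= N] their sum is at most 0. *)
have W_eq A : A \in unitmx -> correlation F Q A ^+ 2 = N.
  move=> uA; apply/eqP; rewrite eq_sym -subr_eq0; apply/eqP.
  apply: (psumr_eq0P (P := [in unitmx])
    (F := fun A => N - correlation F Q A ^+ 2)) => // [B uB|].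
    by rewrite subr_ge0 W_le.
  apply/eqP; rewrite eq_le; apply/andP; split; last first.
    by apply: sumr_ge0 => B uB; rewrite subr_ge0 W_le.
  have N1 : 0 < N - 1 by lia.
  rewrite sumrB -(pmulr_rle0 _ N1) mulrBr moment2.
  have -> : \sum_(B : 'M['F_2]_n | B \in unitmx) N = G * N.
    by rewrite mulr_suml; apply: eq_bigr => B _; rewrite mul1r.
  have -> : (N - 1) * (G * N) - G * (N ^+ 2 - (\sum_a Q a) ^+ 2) =
    - (G * (N - (\sum_a Q a) ^+ 2)) by ring.
  by rewrite oppr_le0 mulr_ge0 // subr_ge0.
pose T3 := \sum_(A in unitmx) Q (a0 *m A) * Q (b0 *m A) * Q (c0 *m A).
pose Tl := \sum_(A in unitmx) Q (a0 *m A) * Q (b0 *m A) * Q ((a0 + b0) *m A).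
pose E1 := \sum_(A in unitmx) Q (a0 *m A).
pose E2 := \sum_(A in unitmx) Q (a0 *m A) * Q (b0 *m A).
pose be := 2 * (Q 0 * G - E1 - Q 0 * E2 + 2 * T3 - Tl) * F 0.
(* [N * E1] is the left side of [third_moment] once all squared correlations equal [N]. *)
pose K := N * E1 - ((E1 - T3) * N - 2 * (Q 0 * E2 - T3) - 2 * (E1 - T3)).
have rel c : c != 0 -> (Tl - T3) * autocorr F c + be * F c = K.
  move=> cN; have := third_moment F_sq Q_sq F_sum ind0 cN.
  under eq_bigr => A uA do rewrite (W_eq A uA).
  rewrite -mulr_sumr (GL_sum1 Q cN (proj1 (andP ind0))) -/E1 => h.
  by rewrite /K h /be -/T3 -/Tl -/E2; ring.
have [al0 | alN] := eqVneq (Tl - T3) 0; last exact: fourier_extremal Ns s4 alN rel.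
exfalso; have degen := degenerate_coefficient Q_sq ind0 Qa0 Qb0 Qc0.
have be0 : be != 0.
  have -> : be = 2 * F 0 * (Q 0 * G - E1 - Q 0 * E2 + T3).
    by rewrite /be -[Tl](subrK T3) al0; ring.
  rewrite !mulf_neq0 //.
    by apply: contraTneq isT => h; have := F_sq 0; rewrite h.
  by apply: contraTneq degen => h; rewrite -/E1 -/E2 -/T3 -/G h mulr0 ltxx.
have constF c : c != 0 -> F c = F a0.
  move=> cN; apply: (mulfI be0).
  by have := rel c cN; rewrite al0 mul0r add0r => ->;
     have := rel a0 (proj1 (andP ind0)); rewrite al0 mul0r add0r.
(* Zero sum would now require [F 0 = - (N - 1) * F a0], impossible for signs when [N >= 16]. *)
have := F_sum; rewrite (bigD1 0) //= (eq_bigr (fun=> F a0)) //.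
have -> : \sum_(i : V | i != 0) F a0 = (N - 1) * F a0.
  by rewrite mulrBl mul1r -sum_const [X in _ = X - _](bigD1 (0 : V)) //= addrAC subrr add0r.
by case: (sq_eq1 (F_sq 0)) => ->; case: (sq_eq1 (F_sq a0)) => ->; lia.
Qed.

(** Equality case of the triangle inequality: the nonnegative terms
    [1 - (-1)^(f a) * character w a * sgn2 b] sum to zero, so each vanishes. *)
Lemma fourier_extremal_affine (f : boolfun n) w :
  fourier (fun a => sgn2 (f a)) w = N \/ fourier (fun a => sgn2 (f a)) w = - N ->
  affine f.
Proof.
move=> h; have [b hb] : exists b : 'F_2, fourier (fun a => sgn2 (f a)) w = N * sgn2 b.
  by case: h => ->; [exists 0 | exists 1]; rewrite ?mulr1 ?mulrN1.
exists w, b => a; apply: sgn2_inj; rewrite sgn2D -/(character w a).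
have : \sum_a (1 - sgn2 (f a) * character w a * sgn2 b) = 0.
  rewrite sumrB sum_const mulr1 -mulr_suml -/(fourier (fun a => sgn2 (f a)) w) hb.
  by rewrite -mulrA sgn2_sq mulr1 subrr.
move/psumr_eq0P => /(_ _ a isT) e.
have {}e : sgn2 (f a) * character w a * sgn2 b = 1.
  apply/eqP; rewrite eq_sym -subr_eq0; apply/eqP; apply: e => c _.
  rewrite /character; case: (sq_eq1 (sgn2_sq (f c))) => ->;
  case: (sq_eq1 (sgn2_sq b)) => ->;
  by case: (sq_eq1 (sgn2_sq (\sum_(i < n) c 0 i * w 0 i))) => ->.
move: e; rewrite /character; case: (sq_eq1 (sgn2_sq (f a))) => ->;
  case: (sq_eq1 (sgn2_sq b)) => ->;
  by case: (sq_eq1 (sgn2_sq (\sum_(i < n) a 0 i * w 0 i))) => ->.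
Qed.

Lemma sum_sgn2 (h : V -> 'F_2) :
  \sum_a sgn2 (h a) = N - 2 * #|[set a | h a == 1]|%:Z.
Proof.
have -> : #|[set a | h a == 1]|%:Z = \sum_a (h a == 1)%:R.
  rewrite -sum1dep_card -natz natr_sum big_mkcond /=; apply: eq_bigr => a _.
  by case: (h a == 1).
have -> : N = \sum_(a : V) 1 by rewrite sum_const mulr1.
rewrite mulr_sumr -sumrB; apply: eq_bigr => a _.
by case: (F2_cases (h a)) => ->.
Qed.

Lemma exists_outside (P : {set V}) (l : seq V) :
  (size l < #|P|)%N -> exists2 x, x \in P & x \notin l.
Proof.
move=> h; apply/exists_inP; apply: contraLR h; rewrite negb_exists_in -leqNgt => /forall_inP h.
apply: leq_trans (card_size l); apply: subset_leq_card; apply/subsetP => x xP.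
by have := h x xP; rewrite negbK.
Qed.

Lemma card_fibre_compl (q : boolfun n) :
  (#|[set a | q a == 0%R]| + wt q)%N = #|{: V}|.
Proof.
rewrite addnC -(cardC [set a | q a == 1]); congr addn; apply: eq_card => a.
by rewrite !inE; case: (F2_cases (q a)) => ->.
Qed.

(** Take [a], [b] where [q] differs from [q 0], hence nonzero, and [c] in the other fibre. The 4
    counts the vectors [0], [a], [b], [a + b] that [c] must avoid. *)
Lemma exists_base_points (q : boolfun n) :
  (4 < wt q)%N -> (wt q + 4 < #|{: V}|)%N ->
  exists a b c, [/\ independent3 a b c, sgn2 (q a) = - sgn2 (q 0),
    sgn2 (q b) = - sgn2 (q 0) & sgn2 (q c) = sgn2 (q 0)].
Proof.
move=> h1; rewrite -(card_fibre_compl q) addnC ltn_add2r => h0.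
have big (v : 'F_2) : (4 < #|[set a | q a == v%R]|)%N by case: (F2_cases v) => ->.
have [a] := @exists_outside [set a | q a == q 0 + 1] [::] (ltn_trans (ltn0Sn _) (big _)).
have [b] := @exists_outside [set a | q a == q 0 + 1] [:: a] (ltn_trans (isT : 1 < 4)%N (big _)).
have [c] := @exists_outside [set a | q a == q 0] [:: 0; a; b; a + b] (big _).
rewrite !inE !negb_or => /eqP qc /and4P[c0 ca cb cab] /eqP qb ba /eqP qa _.
have sN : sgn2 (q 0 + 1) = - sgn2 (q 0) by rewrite sgn2D mulrN1.
have neq0 x : q x = q 0 + 1 -> x != 0.
  move=> hx; apply/eqP => x0; move: hx; rewrite x0.
  by case: (F2_cases (q 0)) => ->.
exists a, b, c; rewrite qa qb qc sN; split=> //.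
by rewrite /independent3 (neq0 a) ?(neq0 b) ?c0 ?ca ?cb ?cab ?(eq_sym a b) ?ba.
Qed.

(** After dropping [I_q^2] it remains that [s^4 <= (s^2 - 1) (s + 1)^2], that is,
    [2 s + 1 <= 2 s^3]. *)
Lemma rho_le (R : realType) (q : boolfun n) (s : int) :
  2 <= s -> (2 : int) ^+ n = s * s -> rho R q <= s + 1.
Proof.
move=> s2 Ns; rewrite /rho ceil_le_int.
have s1 : 0 <= (s + 1)%:~R :> R by rewrite ler0z; lia.
rewrite -[leRHS]ger0_norm // -sqrtr_sqr; apply: ler_wsqrtr.
have NR : (2 : R) ^+ n = s%:~R * s%:~R by rewrite -intrM -Ns rmorphXn.
have s2R : (2 : R) <= s%:~R by rewrite (ler_int R 2).
rewrite mulnC exprM NR intrD.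
have := sqr_ge0 ((Iq q)%:~R : R); move: (s%:~R : R) s2R ((Iq q)%:~R : R) => t t2 i i0.
have t4 : 0 <= (t - 2) * (t + 2) by apply: mulr_ge0; lra.
have t3 : 0 <= t * (t * t - 4) by apply: mulr_ge0; lra.
by rewrite ler_pdivrMr; lra.
Qed.

End NearlyBent.

Theorem theorem7 (R : realType) (n : nat) (q : boolfun n)
    (hn : 2 < n) (heven : ~~ odd n)
    (hwt : 2 ^ n.-1 - 2 ^ (n./2).-1 <= wt q <= 2 ^ n.-1) :
  ~ exists f : boolfun n, nonlinear f /\ nearly_bent R q f.
Proof.
case=> f [nonlin [bal W_le]]; apply: nonlin.
pose k := 2 ^ (n./2).-1; pose s := 2 * k.
have n2 : n = (n./2 + n./2) by rewrite addnn even_halfK.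
have k2 : 2 <= k by rewrite -{1}[2]expn1 leq_exp2l //; lia.
have sE : 2 ^ n./2 = s by rewrite /s -expnS prednK //; lia.
have Ns : 2 ^ n = s * s by rewrite -sE -expnD -n2.
have N2 : 2 ^ n = 2 * 2 ^ n.-1 by rewrite -expnS prednK //; lia.
have cardV : #|{: 'rV['F_2]_n}| = 2 ^ n by rewrite card_mx card_Fp // mul1n.
have k_le : 2 * k <= k * k by rewrite leq_mul2r k2 orbT.
have N1E : 2 ^ n.-1 = 2 * (k * k) by move: Ns; rewrite N2 /s; lia.
rewrite N1E -/k in hwt bal; case/andP: hwt => wt_ge wt_le.
have sq_le (x : int) : (- Posz s <= x <= Posz s)%R -> (x ^+ 2 <= Posz #|{: 'rV['F_2]_n}|)%R.
  move=> hx; have : (0 <= (Posz s - x) * (Posz s + x))%R by apply: Num.Theory.mulr_ge0; lia.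
  by rewrite cardV Ns PoszM GRing.expr2; lia.
(* As [k >= 2], the weight is at least [2 k^2 - k >= 6], and at least [2 k^2 >= 8] vectors lie
   outside the support of [q]. *)
have [|| a [b [c [ind qa qb qc]]]] := @exists_base_points n q.
- by lia.
- by rewrite cardV N2 N1E; lia.
have [w hw] : exists w, fourier (fun a => sgn2 (f a)) w = Posz #|{: 'rV['F_2]_n}| \/
    fourier (fun a => sgn2 (f a)) w = (- Posz #|{: 'rV['F_2]_n}|)%R.
  apply: (@small_correlation_extremal n (fun a => sgn2 (f a)) (fun a => sgn2 (q a))
    (Posz s) a b c) => //.
  - by move=> x; apply: sgn2_sq.
  - by move=> x; apply: sgn2_sq.
  - by rewrite sum_sgn2 -/(wt f) cardV N2 N1E bal; lia.
  - by rewrite cardV Ns.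
  - by rewrite /s; lia.
  (* The weight bounds on [q] say exactly that [I_q = N - 2 wt(q)] lies between 0 and [s]. *)
  - by apply: sq_le; rewrite sum_sgn2 -/(wt q) cardV N2 N1E /s; lia.
  - move=> A uA; apply: sq_le.
    have rho_s : (rho R q <= Posz s + 1)%R by apply: rho_le; [lia | by rewrite -PoszM -Ns -GRing.natrX natz].
    have W_s : (`|\sum_a sgn2 (f a + lin_act q A a)| <= rho R q)%R.
      rewrite (_ : \sum_a _ = Wq q f A)%R ?W_le //.
      by apply: eq_bigr => x _; rewrite sgn2D /sgn2 -GRing.exprD.
    have -> : correlation (fun a => sgn2 (f a)) (fun a => sgn2 (q a)) A =
        (\sum_a sgn2 (f a + lin_act q A a))%R.
      by apply: eq_bigr => x _; rewrite sgn2D ffunE.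
    (* Parity: the sum and s are even, so the bound s + 1 improves to s. *)
    by move: W_s; rewrite sum_sgn2 cardV Ns /s; lia.
exact: fourier_extremal_affine hw.
Qed.
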